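(* Let $X$ be a finite set. The map $f\mapsto \mathrm{Bas}(f)$ is a bijection from the set $\mathbf{PF}(X)$ of Plott functions on $X$ onto the set of convex subsets of $\mathbf{SW}(X)$, and this bijection is compatible with the order structure, where $\mathbf{PF}(X)$ is ordered by $\le$ and convex subsets are ordered by inclusion. In particular, the lattice $\mathbf{PF}(X)$ of Plott functions on $X$ is isomorphic to the lattice of convex subsets of $\mathbf{SW}(X)$. For Plott functions $f_1,f_2$ on $X$ with basements $C_1,C_2$, the meet $f_1\wedge f_2$ in $\mathbf{PF}(X)$ corresponds to the convex set $C_1\cap C_2$, and the join $f_1\vee f_2$ corresponds to the convex hull of $C_1\cup C_2$ (the smallest convex subset containing $C_1\cup C_2$).
   Context: All sets are finite. A choice function on $X$ is a map $f:2^X\to 2^X$ with $f(A)\subset A$ for all $A\subset X$ (empty values are allowed). $f$ is a Plott function if $f(A\cup B)=f(f(A)\cup B)$ for all $A,B\subset X$. For choice functions, $f\le g$ means $f(A)\subset g(A)$ for all $A\subset X$. With this order the set $\mathbf{PF}(X)$ of Plott functions is a lattice; its join is $(f\vee g)(A)=f(A)\cup g(A)$ and $f\wedge g$ is the greatest Plott function that is $\le f$ and $\le g$. A simple word over $X$ is a finite sequence $w=x(1)x(2)\dots x(k)$ ($k\ge 0$, the empty word allowed) of pairwise distinct elements of $X$; $\mathrm{supp}(w)=\{x(1),\dots,x(k)\}$; $\mathbf{SW}(X)$ is the set of simple words over $X$. To $w$ one associates the choice function $l_w$: $l_w(A)=\{x(i)\}$ with $i$ the smallest index such that $x(i)\in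 A$, and $l_w(A)=\emptyset$ if $A\cap \mathrm{supp}(w)=\emptyset$. The functions $l_w$ are exactly the linear Plott functions (Plott functions $l$ with $|l(A)|\le1$ for all $A$), and words are identified with linear Plott functions. The basement of $f$ is $\mathrm{Bas}(f)=\{w\in\mathbf{SW}(X): l_w\le f\}$. For a map of sets $\phi:Z\to X$, the map $\phi_\sharp:\mathbf{SW}(Z)\to\mathbf{SW}(X)$ sends a word $z(1)\dots z(k)$ to the word obtained from $\phi(z(1))\dots\phi(z(k))$ by keeping only the first occurrence of each letter. Given simple words $w_i$ over pairwise disjoint sets $X_i$ ($i\in I$, finite), a shuffle of the $w_i$ is a simple word over $\coprod_i X_i$ whose set of letters is $\coprod_i \mathrm{supp}(w_i)$ and in which, for each $i$, the letters of $w_i$ appear in the same relative order as in $w_i$. Given simple words $w_i$, $i\in I$, over the same set $X$, a melange of them is a word $\delta_\sharp(w)$, where $\delta:X\times I\to X$ is the projection and $w$ is a shuffle of the words $w_i'$, $w_i'$ being the copy of $w_i$ over $X\times\{i\}$. For $w,v\in\mathbf{SW}(X)$, $co(w,v)$ denotes the set of all prefixes (including the empty word and the full word) of all melanges of $w$ and $v$. A subset $C\subset\mathbf{SW}(X)$ is convex if $co(w,v)\subset C$ for all $w,v\in C$.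
   Formalization: Convex subsets of SW(X) in the bijection are taken to be nonempty: the empty set is vacuously convex under the stated definition but is not a basement, since every basement contains the empty word. *)

(* Defs.v *)
From HB Require Import structures.
From mathcomp Require Import all_boot all_order.

Set Implicit Arguments.
Unset Strict Implicit.
Unset Printing Implicit Defensive.

Import Order.TTheory.

(** * Choice functions and Plott functions *)

Definition is_choice (X : finType) (f : {set X} -> {set X}) : bool :=
  [forall A, f A \subset A].

Definition is_plott (X : finType) (f : {set X} -> {set X}) : bool :=
  is_choice f && [forall A, forall B, f (A :|: B) == f (f A :|: B)].

Definition cf_le (X : finType) (f g : {set X} -> {set X}) : bool :=
  [forall A, f A \subset g A].

Record plott_fun (X : finType) := PlottFun {
  pf_val :> {ffun {set X} -> {set X}};
  pf_valP : is_plott pf_val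
}.

HB.instance Definition _ (X : finType) := [isSub for @pf_val X].
HB.instance Definition _ (X : finType) := [Finite of plott_fun X by <:].

Lemma pf_le_refl (X : finType) :
  reflexive (fun f g : plott_fun X => cf_le f g).
Proof. by move=> f; apply/forallP. Qed.

Lemma pf_le_anti (X : finType) :
  antisymmetric (fun f g : plott_fun X => cf_le f g).
Proof.
move=> f g /andP[/forallP fg /forallP gf]; apply/val_inj/ffunP => A.
by apply/eqP; rewrite eqEsubset fg gf.
Qed.

Lemma pf_le_trans (X : finType) :
  transitive (fun f g : plott_fun X => cf_le f g).
Proof.
move=> g f h /forallP fg /forallP gh; apply/forallP => A.
exact: subset_trans (fg A) (gh A).
Qed.

HB.instance Definition _ (X : finType) :=
  Order.Le_isPOrder.Build (Order.Disp tt tt) (plott_fun X)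
    (@pf_le_refl X) (@pf_le_anti X) (@pf_le_trans X).

(* The pointwise union of any set of Plott functions is a Plott function. *)
Definition pf_Union_fun (X : finType) (S : {set plott_fun X}) :=
  [ffun A : {set X} => \bigcup_(f in S) f A].

Lemma pf_Union_subproof (X : finType) (S : {set plott_fun X}) :
  is_plott (pf_Union_fun S).
Proof.
have sub (f : plott_fun X) A : f A \subset A.
  by case/andP: (pf_valP f) => /forallP.
have plo (f : plott_fun X) A B : f (A :|: B) = f (f A :|: B).
  by case/andP: (pf_valP f) => _ /forallP/(_ A)/forallP/(_ B)/eqP.
apply/andP; split; first by apply/forallP => A; rewrite ffunE; apply/bigcupsP.
apply/forallP => A; apply/forallP => B; rewrite !ffunE; apply/eqP.
apply: eq_bigr => f fS.
have fU : f A :|: \bigcup_(g in S) g A = \bigcup_(g in S) g A.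
  by apply/setUidPr; apply: bigcup_sup fS.
have UA : A :|: \bigcup_(g in S) g A = A.
  by apply/setUidPl/bigcupsP.
by rewrite -fU -setUA -plo setUA UA.
Qed.

Definition pf_Union (X : finType) (S : {set plott_fun X}) : plott_fun X :=
  PlottFun (pf_Union_subproof S).

Definition pf_join (X : finType) (f g : plott_fun X) : plott_fun X :=
  pf_Union [set f; g].

Definition pf_meet (X : finType) (f g : plott_fun X) : plott_fun X :=
  pf_Union [set h : plott_fun X | cf_le h f && cf_le h g].

Lemma pf_joinE (X : finType) (f g : plott_fun X) (A : {set X}) :
  pf_join f g A = f A :|: g A.
Proof. by rewrite ffunE bigcup_setU !big_set1. Qed.

Lemma pf_meetP (X : finType) (f g h : plott_fun X) :
  (f <= pf_meet g h)%O = (f <= g)%O && (f <= h)%O.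
Proof.
have le_meet (k : plott_fun X) :
    (forall l : plott_fun X, cf_le l g && cf_le l h -> cf_le l k) ->
    (pf_meet g h <= k)%O.
  move=> H; apply/forallP => A; rewrite ffunE; apply/bigcupsP => l.
  by rewrite inE => /H/forallP.
apply/idP/andP => [le_f | [fg fh]].
  by split; apply: le_trans le_f (le_meet _ _) => l /andP[].
apply/forallP => A; rewrite ffunE.
by apply: (@bigcup_sup _ _ f); rewrite inE; apply/andP.
Qed.

Lemma pf_joinP (X : finType) (f g h : plott_fun X) :
  (pf_join f g <= h)%O = (f <= h)%O && (g <= h)%O.
Proof.
apply/forallP/andP => [le_h | [/forallP fh /forallP gh] A].
  by split; apply/forallP => A; have := le_h A;
     rewrite pf_joinE subUset => /andP[].
by rewrite pf_joinE subUset fh gh.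
Qed.

HB.instance Definition _ (X : finType) :=
  Order.POrder_MeetJoin_isLattice.Build (Order.Disp tt tt) (plott_fun X)
    (@pf_meetP X) (@pf_joinP X).

(** * Simple words *)

Record simple_word (X : finType) := SimpleWord {
  sw_val :> seq X;
  sw_uniq : uniq sw_val
}.

HB.instance Definition _ (X : finType) := [isSub for @sw_val X].
HB.instance Definition _ (X : finType) := [Countable of simple_word X by <:].

(* A simple word has at most #|X| letters, whence finiteness. *)
Lemma sw_size (X : finType) (w : simple_word X) : size w <= #|X|.
Proof. by rewrite -(card_uniqP (sw_uniq w)) max_card. Qed.

Definition sw_to_bseq (X : finType) (w : simple_word X) : {bseq #|X| of X} :=
  Bseq (sw_size w).

Definition sw_of_bseq (X : finType) (s : {bseq #|X| of X}) :
  option (simple_word X) := insub (s : seq X).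

Lemma sw_to_bseqK (X : finType) :
  pcancel (@sw_to_bseq X) (@sw_of_bseq X).
Proof. by move=> w; rewrite /sw_of_bseq valK. Qed.

HB.instance Definition _ (X : finType) :=
  isFinite.Build (simple_word X) (pcan_enumP (@sw_to_bseqK X)).

(* The linear Plott function l_w: the filtered sequence starts with the first
   letter of w that belongs to A. *)
Definition lin (X : finType) (w : simple_word X) (A : {set X}) : {set X} :=
  if [seq x <- w | x \in A] is x :: _ then [set x] else set0.

Definition Bas (X : finType) (f : plott_fun X) : {set simple_word X} :=
  [set w : simple_word X | cf_le (lin w) f].

(** * Shuffles, melanges and convexity *)

(* [undup] keeps the last occurrence of each letter; the two reversals make it
   keep the first one. *)
Lemma sw_push_subproof (Z X : finType) (phi : Z -> X) (w : simple_word Z) :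
  uniq (rev (undup (rev (map phi w)))).
Proof. by rewrite rev_uniq undup_uniq. Qed.

Definition sw_push (Z X : finType) (phi : Z -> X) (w : simple_word Z) :
  simple_word X := SimpleWord (sw_push_subproof phi w).

Lemma sw_copy_subproof (X I : finType) (i : I) (w : simple_word X) :
  uniq [seq (x, i) | x <- w].
Proof. by rewrite map_inj_uniq ?sw_uniq // => x y []. Qed.

Definition sw_copy (X I : finType) (i : I) (w : simple_word X) :
  simple_word (X * I)%type := SimpleWord (sw_copy_subproof i w).

(* The words [ws i] are meant to have pairwise disjoint supports in Y. As u has
   no repeated letter, [subseq (ws i) u] says that the letters of [ws i] occur
   in u in the same relative order as in [ws i]. *)
Definition is_shuffle (Y I : finType) (ws : I -> simple_word Y)
    (u : simple_word Y) : bool :=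
  [forall y, (y \in sw_val u) == [exists i, y \in sw_val (ws i)]]
  && [forall i, subseq (ws i) u].

Definition is_melange (X I : finType) (ws : I -> simple_word X)
    (m : simple_word X) : bool :=
  [exists u : simple_word (X * I)%type,
     is_shuffle (fun i => sw_copy i (ws i)) u && (m == sw_push fst u)].

Definition co (X : finType) (w v : simple_word X) : {set simple_word X} :=
  [set p : simple_word X |
     [exists m : simple_word X,
        is_melange (fun b : bool => if b then v else w) m && prefix p m]].

Definition is_convex (X : finType) (C : {set simple_word X}) : bool :=
  [forall w in C, forall v in C, co w v \subset C].

(* Smallest convex set containing S. *)
Definition hull (X : finType) (S : {set simple_word X}) :
    {set simple_word X} :=
  \bigcap_(C : {set simple_word X} | is_convex C && (S \subset C)) C.

(* set0 satisfies [is_convex] vacuously, but it is not a basement: every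
   basement contains the empty word, and so does every nonempty convex set.
   The convex subsets of the correspondence are thus the nonempty ones. *)
Record convex_set (X : finType) := ConvexSet {
  cs_val :> {set simple_word X};
  cs_valP : is_convex cs_val && (cs_val != set0)
}.

HB.instance Definition _ (X : finType) := [isSub for @cs_val X].
HB.instance Definition _ (X : finType) := [Finite of convex_set X by <:].

Lemma cs_le_refl (X : finType) :
  reflexive (fun C D : convex_set X => cs_val C \subset cs_val D).
Proof. by move=> C; apply: subxx. Qed.

Lemma cs_le_anti (X : finType) :
  antisymmetric (fun C D : convex_set X => cs_val C \subset cs_val D).
Proof. by move=> C D CD; apply/val_inj/eqP; rewrite eqEsubset. Qed.

Lemma cs_le_trans (X : finType) :
  transitive (fun C D : convex_set X => cs_val C \subset cs_val D).
Proof. by move=> D C E; apply: subset_trans. Qed.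

HB.instance Definition _ (X : finType) :=
  Order.Le_isPOrder.Build (Order.Disp tt tt) (convex_set X)
    (@cs_le_refl X) (@cs_le_anti X) (@cs_le_trans X).

Definition sw_nil (X : finType) : simple_word X :=
  @SimpleWord X [::] isT.

Lemma nil_in_co (X : finType) (w v : simple_word X) : sw_nil X \in co w v.
Proof.
pose s := sw_val (sw_copy false w) ++ sw_val (sw_copy true v).
have us : uniq s.
  rewrite cat_uniq !sw_uniq /= andbT; apply/hasPn => _ /mapP[x _ ->].
  by apply/mapP => -[].
rewrite inE; apply/existsP; exists (sw_push fst (SimpleWord us)).
rewrite prefix0s andbT; apply/existsP; exists (SimpleWord us).
rewrite eqxx andbT; apply/andP; split; last first.
  by apply/forallP => -[]; [apply: suffix_subseq | apply: prefix_subseq].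
apply/forallP => y; rewrite mem_cat; apply/eqP.
apply/orP/existsP => [[yw|yv] | [[] yv]].
- by exists false.
- by exists true.
- by right.
- by left.
Qed.

Lemma nil_in_convex (X : finType) (C : {set simple_word X}) :
  is_convex C -> C != set0 -> sw_nil X \in C.
Proof.
move=> /forall_inP cC /set0Pn[w wC].
by have /forall_inP/(_ w wC)/subsetP := cC w wC; apply; apply: nil_in_co.
Qed.

Lemma convexP (X : finType) (C : {set simple_word X}) :
  reflect (forall w v, w \in C -> v \in C -> co w v \subset C) (is_convex C).
Proof.
apply: (iffP forall_inP) => [cC w v wC | cC w wC].
  by move: v; apply/forall_inP/cC.
by apply/forall_inP => v; apply: cC.
Qed.

Lemma convexI (X : finType) (C D : {set simple_word X}) :
  is_convex C -> is_convex D -> is_convex (C :&: D).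
Proof.
move=> /convexP cC /convexP cD; apply/convexP => w v.
rewrite !inE subsetI => /andP[wC wD] /andP[vC vD].
by rewrite cC // cD.
Qed.

Lemma convex_hull (X : finType) (S : {set simple_word X}) :
  is_convex (hull S).
Proof.
apply/convexP => w v /bigcapP wS /bigcapP vS; apply/bigcapsP => C PC.
by case/andP: (PC) => /convexP cC _; apply: cC; [apply: wS | apply: vS].
Qed.

Lemma sub_hull (X : finType) (S : {set simple_word X}) : S \subset hull S.
Proof. by apply/bigcapsP => C /andP[]. Qed.

Lemma hull_min (X : finType) (S C : {set simple_word X}) :
  is_convex C -> S \subset C -> hull S \subset C.
Proof. by move=> cC SC; apply: bigcap_inf; rewrite cC. Qed.

Lemma cs_meet_subproof (X : finType) (C D : convex_set X) :
  is_convex (C :&: D) && (C :&: D != set0).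
Proof.
case/andP: (cs_valP C) (cs_valP D) => cC C0 /andP[cD D0].
rewrite convexI //=; apply/set0Pn; exists (sw_nil X).
by rewrite inE !nil_in_convex.
Qed.

Definition cs_meet (X : finType) (C D : convex_set X) : convex_set X :=
  ConvexSet (cs_meet_subproof C D).

Lemma cs_join_subproof (X : finType) (C D : convex_set X) :
  is_convex (hull (C :|: D)) && (hull (C :|: D) != set0).
Proof.
rewrite convex_hull /=; case/andP: (cs_valP C) => _ /set0Pn[w wC].
by apply/set0Pn; exists w; apply: (subsetP (sub_hull _)); rewrite inE wC.
Qed.

Definition cs_join (X : finType) (C D : convex_set X) : convex_set X :=
  ConvexSet (cs_join_subproof C D).

Lemma cs_meetP (X : finType) (C D E : convex_set X) :
  (C <= cs_meet D E)%O = (C <= D)%O && (C <= E)%O.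
Proof. exact: subsetI. Qed.

Lemma cs_joinP (X : finType) (C D E : convex_set X) :
  (cs_join C D <= E)%O = (C <= E)%O && (D <= E)%O.
Proof.
have -> : (C <= E)%O && (D <= E)%O = (C :|: D \subset E) by rewrite subUset.
apply/idP/idP => [|CDE]; first exact: subset_trans (sub_hull _).
by apply: hull_min => //; case/andP: (cs_valP E).
Qed.

HB.instance Definition _ (X : finType) :=
  Order.POrder_MeetJoin_isLattice.Build (Order.Disp tt tt) (convex_set X)
    (@cs_meetP X) (@cs_joinP X).

(* Main.v *)
Require Import Defs.
From mathcomp Require Import all_boot all_order.

Set Implicit Arguments.
Unset Strict Implicit.
Unset Printing Implicit Defensive.

Import Order.TTheory.

(** Call a word m greedy for a choice function F if each of its letters x
belongs to F(X \ p), where p is the part of m before x. Both sides of the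
correspondence are governed by this one notion.

On the side of choice functions, heredity shows that the basement of a Plott
function f consists of the words greedy for f ([BasP]). Moreover, f is the union
of the l_w for w in its basement ([plott_word]): given x in f(A), take a longest
greedy word p avoiding A; no letter outside A can be added to it, so
f(X \ p) lies in A, hence equals f(A) by the outcast property, and px is the
required word. So f can be recovered from Bas(f), and Bas reflects the order
([Bas_le]).

On the side of words, co(w, v) consists of the words greedy for l_w \/ l_v
([coP]): a letter surviving in a melange is the first letter of w or of v that
has not occurred yet, and conversely a greedy word tells which of the two words
a shuffle has to read next. Hence basements are convex ([Bas_convex]). For a
nonempty convex C, let f be the union of the l_c for c in C. If pxs is in
Bas(f) and p is in C, then x is in l_c(X \ p) for some c in C, so px is greedy
for l_p \/ l_c, thus lies in co(p, c) and in C. By induction on prefixes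
Bas(f) = C ([Bas_plott_of]).

So Bas is an isomorphism of posets, and such a map preserves meets and joins. *)

(** * Linear choice functions *)

(** The body of [lin], on arbitrary sequences: inductions and decompositions
of words are then free of uniqueness proofs. *)
Definition lin_seq (X : finType) (s : seq X) (A : {set X}) : {set X} :=
  if [seq x <- s | x \in A] is x :: _ then [set x] else set0.

Lemma linE (X : finType) (w : simple_word X) A : lin w A = lin_seq w A.
Proof. by []. Qed.

Lemma lin_cons (X : finType) (x : X) s (A : {set X}) :
  lin_seq (x :: s) A = if x \in A then [set x] else lin_seq s A.
Proof. by rewrite /lin_seq /=; case: ifP. Qed.

Lemma lin_cat (X : finType) (s1 s2 : seq X) (A : {set X}) :
  {in s1, forall y, y \notin A} -> lin_seq (s1 ++ s2) A = lin_seq s2 A.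
Proof.
move=> s1A; rewrite /lin_seq filter_cat.
suff -> : [seq x <- s1 | x \in A] = [::] by [].
by apply/eqP; rewrite -(negbK (_ == _)) -has_filter; apply/hasPn.
Qed.

Lemma lin_split (X : finType) (s : seq X) (A : {set X}) x :
  x \in lin_seq s A ->
  exists s1 s2, [/\ s = s1 ++ x :: s2, x \in A & {in s1, forall y, y \notin A}].
Proof.
elim: s => [|a s IH]; first by rewrite inE.
rewrite lin_cons; case: ifP => [aA /set1P-> | aA /IH[s1 [s2 [-> xA s1A]]]].
  by exists [::], s.
exists (a :: s1), s2; split=> // y; rewrite inE => /predU1P[->|/s1A //].
by rewrite aA.
Qed.

Lemma lin_plott (X : finType) (w : simple_word X) :
  is_plott [ffun A => lin w A].
Proof.
have sub s (A : {set X}) : lin_seq s A \subset A.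
  by apply/subsetP => x /lin_split[s1 [s2 []]].
apply/andP; split; first by apply/forallP => A; rewrite ffunE sub.
apply/forallP => A; apply/forallP => B; rewrite !ffunE !linE; apply/eqP.
elim: (sw_val w) => [|x s IH]; first by [].
rewrite !lin_cons !in_setU; case: (boolP (x \in A)) => xA /=.
  by rewrite set11.
case: (x \in B) => /=; rewrite ?orbT ?orbF //.
by rewrite (contraNF (subsetP (sub s A) x) xA).
Qed.

Definition lin_pf (X : finType) (w : simple_word X) : plott_fun X :=
  PlottFun (lin_plott w).

(** * Plott functions and their basements *)

Section Plott.
Variables (X : finType) (f : plott_fun X).
Implicit Types A B : {set X}.

Lemma plott_sub A : f A \subset A.
Proof. by case/andP: (pf_valP f) => /forallP. Qed.

Lemma plott_path A B : f (A :|: B) = f (f A :|: B).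
Proof. by case/andP: (pf_valP f) => _ /forallP/(_ A)/forallP/(_ B)/eqP. Qed.

Lemma plott_heredity A B x : A \subset B -> x \in f B -> x \in A -> x \in f A.
Proof.
move=> AB xB xA; have := plott_path A (B :\: A).
rewrite setDE setUIr setUCr setIT (setUidPr AB) => fB.
move: xB; rewrite fB => /(subsetP (plott_sub _)).
by rewrite in_setU in_setI in_setC xA andbF orbF.
Qed.

(** Both members equal f(f(B) U A), by path independence. *)
Lemma plott_outcast A B : f B \subset A -> A \subset B -> f A = f B.
Proof. by move=> BA AB; rewrite -(setUidPl AB) plott_path (setUidPr BA). Qed.

End Plott.

Definition unused (X : finType) (p : seq X) : {set X} := [set y | y \notin p].

(** Greediness is a property of sequences, so that it passes to prefixes and
extensions without a proof of uniqueness. *)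
Definition greedy (X : finType) (F : {set X} -> {set X}) (m : seq X) : Prop :=
  forall p x s, m = p ++ x :: s -> x \in F (unused p).

Lemma greedy_rcons (X : finType) (F : {set X} -> {set X}) p x :
  greedy F p -> x \in F (unused p) -> greedy F (rcons p x).
Proof.
move=> gp xp q y s; case/lastP: s => [|s z].
  by rewrite cats1 => /rcons_inj[<- <-].
by rewrite -rcons_cons -rcons_cat => /rcons_inj[/gp].
Qed.

Lemma lin_greedy (X : finType) (w : simple_word X) : greedy (lin w) w.
Proof.
move=> p x s wE; have := sw_uniq w; rewrite linE wE cat_uniq /= negb_or.
case/and3P=> _ /andP[xp _] _.
by rewrite lin_cat => [|y yp]; rewrite ?lin_cons inE ?yp // xp set11.
Qed.

(** If x is the first letter of w in A and p is the part of w before x, then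
A is contained in X \ p; heredity brings x from f(X \ p) down to f(A). *)
Lemma BasP (X : finType) (f : plott_fun X) (w : simple_word X) :
  w \in Bas f <-> greedy f w.
Proof.
rewrite inE; split=> [/forallP wf p x s /lin_greedy | gw].
  exact: subsetP (wf _) x.
apply/forallP => A; apply/subsetP => x; rewrite linE.
case/lin_split=> s1 [s2 [/gw xf xA s1A]]; apply: plott_heredity xf xA.
by apply/subsetP => y yA; rewrite inE; apply: contraL yA => /s1A.
Qed.

Lemma rcons_sw (X : finType) (p : simple_word X) x :
  x \notin sw_val p -> exists q : simple_word X, sw_val q = rcons p x.
Proof.
move=> xp; have u : uniq (rcons p x) by rewrite rcons_uniq xp sw_uniq.
by exists (SimpleWord u).
Qed.

Lemma Bas_rcons (X : finType) (f : plott_fun X) (p : simple_word X) x :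
  p \in Bas f -> x \in f (unused p) ->
  exists2 q, q \in Bas f & sw_val q = rcons p x.
Proof.
move=> /BasP gp xf; have := subsetP (plott_sub f _) x xf.
rewrite inE => /rcons_sw[q qE]; exists q => //.
by apply/BasP; rewrite qE; apply: greedy_rcons.
Qed.

(** A longest word p of Bas(f) avoiding A satisfies f(X \ p) <= A, since it
could otherwise be extended; then f(X \ p) = f(A), and w = px will do. *)
Lemma plott_word (X : finType) (f : plott_fun X) (A : {set X}) x :
  x \in f A -> exists2 w, w \in Bas f & x \in lin w A.
Proof.
move=> xfA; pose P (p : simple_word X) := (p \in Bas f) && (A \subset unused p).
have P0 : P (sw_nil X).
  apply/andP; split; first by apply/BasP => -[].
  by apply/subsetP => y _; rewrite inE.
case: (arg_maxnP (fun p : simple_word X => size p) P0) => p /andP[pB pA] pmax.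
(* A letter of f (unused p) outside A would extend p. *)
have fpA : f (unused p) \subset A.
  apply/subsetP => y yf; apply: contraT => yA.
  have [q qB qE] := Bas_rcons pB yf.
  suff /pmax : P q by rewrite /= qE size_rcons ltnn.
  rewrite /P qB; apply/subsetP => z zA; have := subsetP pA z zA.
  by rewrite !inE qE mem_rcons inE negb_or => ->; rewrite andbT (memPn yA).
move: xfA; rewrite (plott_outcast fpA pA) => xf.
have [q qB qE] := Bas_rcons pB xf; exists q => //.
rewrite linE qE -cats1 lin_cat => [|y yp].
  by rewrite lin_cons (subsetP fpA x xf) set11.
by apply: contraL yp => /(subsetP pA); rewrite inE.
Qed.

Lemma Bas_le (X : finType) (f g : plott_fun X) :
  (Bas f \subset Bas g) = (f <= g)%O.
Proof.
apply/subsetP/idP => [fg | fg w].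
  apply/forallP => A; apply/subsetP => x /plott_word[w /fg].
  by rewrite inE => /forallP/(_ A)/subsetP; apply.
rewrite !inE => /forallP wf; apply/forallP => A.
by apply: subset_trans (wf A) _; apply: (forallP fg).
Qed.

(** * Melanges *)

(** The first occurrences of the letters of s, as in [sw_push]. *)
Definition dedup (T : eqType) (s : seq T) := rev (undup (rev s)).

Lemma dedup_cat (T : eqType) (s t : seq T) :
  dedup (s ++ t) = dedup s ++ [seq y <- dedup t | y \notin s].
Proof.
rewrite /dedup rev_cat undup_cat rev_cat -filter_rev; congr (_ ++ _).
by apply: eq_filter => y; rewrite mem_rev.
Qed.

Lemma dedup_cons (T : eqType) (x : T) t :
  dedup (x :: t) = x :: [seq y <- dedup t | y != x].
Proof.
by rewrite -cat1s dedup_cat; congr (_ :: _); apply: eq_filter => y; rewrite inE.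
Qed.

Lemma mem_dedup (T : eqType) (s : seq T) : dedup s =i s.
Proof. by move=> x; rewrite mem_rev mem_undup mem_rev. Qed.

(** A letter x survives in [dedup t] from its first occurrence in t; the same
letters precede it in t and in [dedup t]. *)
Lemma dedup_split (T : eqType) (t p s : seq T) x :
  dedup t = p ++ x :: s -> exists t1 t2, t = t1 ++ x :: t2 /\ t1 =i p.
Proof.
move=> tE; have : x \in t by rewrite -mem_dedup tE mem_cat inE eqxx orbT.
have xp : x \notin p.
  have : uniq (dedup t) by rewrite rev_uniq undup_uniq.
  by rewrite tE cat_uniq /= negb_or => /and3P[_ /andP[]].
pose k := index x t => xt.
have kE : t = take k t ++ x :: drop k.+1 t.
  by rewrite -drop_index ?cat_take_drop.
have xk : x \notin take k t by rewrite in_take ?ltnn.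
exists (take k t), (drop k.+1 t); split=> // z.
move/eqP: tE; rewrite {1}kE dedup_cat dedup_cons /= xk.
by rewrite eqseq_pivot2l ?mem_dedup // => /andP[/eqP<- _]; rewrite mem_dedup.
Qed.

(** The surviving x comes from some copy (x, i) in the shuffle u. The letters of
[ws i] before x precede (x, i) in u, so they all occur before x in m; hence x is
the first letter of [ws i] outside p. *)
Lemma melange_greedy (X I : finType) (ws : I -> simple_word X)
    (m : simple_word X) p x s :
  is_melange ws m -> sw_val m = p ++ x :: s ->
  exists i, x \in lin (ws i) (unused p).
Proof.
case/existsP=> u /andP[/andP[/forallP umem /forallP usub] /eqP muE] mE.
have /dedup_split[t1 [t2 [uE t1p]]] : dedup (map fst u) = p ++ x :: s.
  by rewrite -mE muE.
(* Restricting the shuffle to the letters of index i gives back the i-th word. *)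
have copyE i : [seq y <- u | y.2 == i] = [seq (x, i) | x <- ws i].
  have /(subseq_uniqP (sw_uniq u)) cE := usub i.
  rewrite -[RHS]/(sw_val (sw_copy i (ws i))) cE.
  apply: eq_in_filter => -[y j] /=; rewrite (eqP (umem (y, j))).
  case/existsP=> k /mapP[z zk [-> ->]].
  by apply/eqP/mapP => [<- | [z' _ []]] //; exists z.
(* Lift the splitting t1 ++ x :: t2 of the projection to u itself. *)
pose k := size t1; have := uE; rewrite -(cat_take_drop k u) map_cat.
move/eqP; rewrite eqseq_cat ?size_map ?size_takel //; last first.
  by rewrite -(size_map fst) uE size_cat leq_addr.
case/andP=> /eqP u1E; case du : (drop k u) => [|[a i] u2] //=.
case/andP=> /eqP/= ax _; rewrite {}ax in du; exists i.
have wsE : sw_val (ws i) = map fst [seq y <- u | y.2 == i].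
  by rewrite copyE -map_comp map_id.
have xp : x \notin p.
  have := sw_uniq m; rewrite mE cat_uniq /= negb_or.
  by case/and3P=> _ /andP[].
rewrite linE wsE -(cat_take_drop k u) du filter_cat map_cat /= eqxx /=.
rewrite lin_cat => [|y]; first by rewrite lin_cons inE xp set11.
case/mapP=> z; rewrite mem_filter => /andP[_ zu] ->.
by rewrite inE negbK -t1p -u1E map_f.
Qed.

Lemma filter_tag_flatten (X I : finType) (ws : I -> seq X) i :
  [seq y <- flatten [seq [seq (x, j) | x <- ws j] | j <- enum I] | y.2 == i] =
  [seq (x, i) | x <- ws i].
Proof.
have tagE j : [seq y <- [seq (x, j) | x <- ws j] | y.2 == i] =
    if j == i then [seq (x, i) | x <- ws i] else [::].
  rewrite filter_map; have [->|ji] := eqVneq j i.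
    by rewrite (eq_filter (a2 := predT)) ?filter_predT // => z /=; rewrite eqxx.
  by rewrite (eq_filter (a2 := pred0)) ?filter_pred0 // => z /=;
    rewrite (negPf ji).
rewrite filter_flatten -map_comp (eq_map tagE).
have : i \in enum I by rewrite mem_enum.
elim: (enum I) (enum_uniq I) => //= j r IH /andP[jr ur].
rewrite inE => /predU1P[ij|ir]; last first.
  by rewrite ifN ?IH //; apply: contraNneq jr => ->.
rewrite -ij eqxx (_ : flatten _ = [::]) ?cats0 //.
elim: r jr {IH ur} => //= k r IH.
by rewrite inE negb_or -ij eq_sym => /andP[/negPf-> ir]; apply: IH; rewrite -ij.
Qed.

(** The shuffle is read off m: if the next letter x of m is the first letter of
[ws i] not yet seen, then [ws i] = w1 ++ x :: w2 with w1 already seen; emit the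
copy of w1 x, whose only new letter is x, and go on with w2 in place of [ws i].
The sequence S of letters already seen makes the induction on m possible. *)
Lemma interleave (X I : finType) (m : seq X) (ws : I -> seq X) (S : seq X) :
  (forall p x s, m = p ++ x :: s ->
     exists i, x \in lin_seq (ws i) (unused (S ++ p))) ->
  exists u : seq (X * I),
    (forall i, [seq y <- u | y.2 == i] = [seq (x, i) | x <- ws i]) /\
    prefix m [seq y <- dedup (map fst u) | y \notin S].
Proof.
elim: m ws S => [|x m IH] ws S mS.
  (* Nothing is prescribed any more: concatenate what remains. *)
  exists (flatten [seq [seq (x, j) | x <- ws j] | j <- enum I]).
  by rewrite prefix0s; split=> // i; apply: filter_tag_flatten.
have [i] := mS [::] x m erefl; rewrite cats0 => /lin_split[w1 [w2 [iE]]].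
rewrite inE => xS w1S.
pose ws' j := if j == i then w2 else ws j.
have [|u [uw pm]] := IH ws' (x :: S).
  move=> p y s mE; have [j] := mS (x :: p) y s (congr1 (cons x) mE).
  have -> : unused (S ++ x :: p) = unused ((x :: S) ++ p).
    by apply/setP => z; rewrite !inE !mem_cat !inE orbCA orbA.
  move=> yj; exists j; rewrite /ws'; case: eqP yj => // ->.
  rewrite iE -cat_rcons lin_cat // => z.
  rewrite mem_rcons [z \in unused _]inE negbK mem_cat !inE.
  by case/predU1P=> [->|/w1S]; rewrite ?eqxx // inE negbK => ->; rewrite orbT.
exists ([seq (z, i) | z <- rcons w1 x] ++ u); split=> [j|].
  rewrite filter_cat uw /ws' filter_map; have [->|ji] := eqVneq j i.
    rewrite (eq_filter (a2 := predT)) ?filter_predT.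
      by rewrite -map_cat iE cat_rcons.
    by move=> z /=; rewrite eqxx.
  rewrite (eq_filter (a2 := pred0)) ?filter_pred0 // => z /=.
  by rewrite eq_sym (negPf ji).
(* After removal of S, the projection of the copy of w1 x contributes x alone. *)
rewrite map_cat -map_comp map_id cat_rcons dedup_cat dedup_cons filter_cat.
rewrite (_ : [seq y <- dedup w1 | y \notin S] = [::]) /=; last first.
  rewrite -(filter_pred0 (dedup w1)); apply: eq_in_filter => z.
  by rewrite mem_dedup => /w1S; rewrite inE => /negPf.
have xw1 : x \notin w1 by apply: contra xS => /w1S; rewrite inE negbK.
rewrite xw1 /= xS prefix_cons eqxx -!filter_predI.
rewrite (eq_filter (a2 := [pred y | y \notin x :: S])) //.
move=> z /=; rewrite inE negb_or.
case: (boolP (z \in S)) => zS; rewrite ?andbF //=.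
by rewrite andbC; case: (boolP (z \in w1)) => // /w1S; rewrite inE zS.
Qed.

Lemma greedy_melange (X I : finType) (ws : I -> simple_word X)
    (p : simple_word X) :
  greedy (fun A => \bigcup_i lin (ws i) A) p ->
  exists2 m, is_melange ws m & prefix p m.
Proof.
move=> gp; have [|u [uw pu]] := @interleave X I p ws [::].
  by move=> q x s /gp/bigcupP[i _ xi]; exists i.
have uu : uniq u.
  apply: count_mem_uniq => -[x i].
  have -> : count_mem (x, i) u = count_mem (x, i) [seq y <- u | y.2 == i].
    rewrite count_filter; apply: eq_count => y /=.
    by case: eqP => // ->; rewrite /= eqxx.
  rewrite count_uniq_mem ?mem_filter ?eqxx // uw.
  exact: (sw_uniq (sw_copy i (ws i))).
exists (sw_push fst (SimpleWord uu)); last first.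
  by move: pu; rewrite (eq_filter (a2 := predT)) ?filter_predT.
apply/existsP; exists (SimpleWord uu); rewrite eqxx andbT.
apply/andP; split; last first.
  by apply/forallP => i; rewrite /= -uw filter_subseq.
apply/forallP => -[x i] /=; apply/eqP; apply/idP/existsP => [xu | [j]].
  by exists i; rewrite -uw mem_filter eqxx.
by rewrite -uw mem_filter => /andP[].
Qed.

(** Equivalently, co(w, v) is the basement of l_w \/ l_v. *)
Lemma coP (X : finType) (w v p : simple_word X) :
  p \in co w v <-> greedy (fun A => lin w A :|: lin v A) p.
Proof.
pose ws b := if b then v else w.
rewrite inE; split.
  case/existsP=> m /andP[wm /prefixP[r mE]] q x s pE.
  have [|b] := @melange_greedy _ _ ws m q x (s ++ r) wm.
    by rewrite mE pE -catA.
  by rewrite inE; case: b => ->; rewrite ?orbT.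
move=> gp; have [|m wm pm] := @greedy_melange _ _ ws p.
  move=> q x s /gp; rewrite inE => /orP[xw|xv]; apply/bigcupP.
    by exists false.
  by exists true.
by apply/existsP; exists m; rewrite wm.
Qed.

(** * Basements and convex sets *)

Lemma Bas_convex (X : finType) (f : plott_fun X) :
  is_convex (Bas f) && (Bas f != set0).
Proof.
apply/andP; split; last first.
  by apply/set0Pn; exists (sw_nil X); apply/BasP => -[].
apply/convexP => w v; rewrite !inE => /forallP wf /forallP vf.
apply/subsetP => p /coP gp; apply/BasP => q x s /gp.
by rewrite inE => /orP[/(subsetP (wf _))|/(subsetP (vf _))].
Qed.

Definition plott_of (X : finType) (C : {set simple_word X}) : plott_fun X :=
  pf_Union [set lin_pf w | w in C].

Lemma plott_ofP (X : finType) (C : {set simple_word X}) A x :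
  reflect (exists2 w, w \in C & x \in lin w A) (x \in plott_of C A).
Proof.
rewrite ffunE; apply: (iffP bigcupP) => [[_ /imsetP[w wC ->]]|[w wC xw]].
  by rewrite ffunE; exists w.
by exists (lin_pf w); rewrite ?imset_f // ffunE.
Qed.

Lemma plott_of_Bas (X : finType) (f : plott_fun X) : plott_of (Bas f) = f.
Proof.
apply/val_inj/ffunP => A; apply/setP => x; apply/plott_ofP/idP.
  by case=> w; rewrite inE => /forallP/(_ A)/subsetP; apply.
by case/plott_word=> w; exists w.
Qed.

(** For the inclusion of the basement in C, prefixes of w are shown to be in C
one letter at a time: if p is in C and px is a prefix of w, then x is in
l_c(X \ p) for some c in C, and px is in co(p, c). *)
Lemma Bas_plott_of (X : finType) (C : convex_set X) : Bas (plott_of C) = C.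
Proof.
case/andP: (cs_valP C) => cC C0; apply/eqP; rewrite eqEsubset andbC.
apply/andP; split; apply/subsetP => w.
  move=> wC; rewrite inE; apply/forallP => A; apply/subsetP => x xw.
  by apply/plott_ofP; exists w.
move/BasP=> gw.
suff pC (p : simple_word X) : prefix p w -> p \in cs_val C.
  by apply: pC; apply: prefix_refl.
case: p => p up /= /prefixP[r wE]; rewrite {}wE in gw.
elim/last_ind: p up r gw => [|p x IH] up r gw.
  suff -> : SimpleWord up = sw_nil X by apply: nil_in_convex.
  exact: val_inj.
rewrite cat_rcons in gw.
have up' : uniq p by move: (up); rewrite rcons_uniq => /andP[].
have /plott_ofP[c cC' xc] := gw p x r erefl.
have /subsetP := (elimT (convexP C) cC) _ _ (IH up' _ gw) cC'; apply.
apply/coP; apply: greedy_rcons; last by rewrite inE xc orbT.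
by move=> q y s /(@lin_greedy _ (SimpleWord up')); rewrite inE => ->.
Qed.

(** * The isomorphism of lattices *)

Lemma mono_bij_meet d1 d2 (L1 : latticeType d1) (L2 : latticeType d2)
    (h : L1 -> L2) :
  bijective h -> {mono h : x y / (x <= y)%O} -> {morph h : x y / (x `&` y)%O}.
Proof.
case=> g _ gK hle x y; apply/le_anti; rewrite lexI !hle leIl leIr /=.
by rewrite -[X in (X <= _)%O]gK hle lexI -!hle gK leIl leIr.
Qed.

Lemma mono_bij_join d1 d2 (L1 : latticeType d1) (L2 : latticeType d2)
    (h : L1 -> L2) :
  bijective h -> {mono h : x y / (x <= y)%O} -> {morph h : x y / (x `|` y)%O}.
Proof.
case=> g _ gK hle x y; apply/le_anti; rewrite leUx !hle leUl leUr andbT.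
by rewrite -[X in (_ <= X)%O]gK hle leUx -!hle gK leUl leUr.
Qed.

Theorem mainTheorem2 (X : finType) :
  exists beta : plott_fun X -> convex_set X,
    [/\ forall f : plott_fun X, cs_val (beta f) = Bas f,
        bijective beta,
        {mono beta : f g / (f <= g)%O},
        {morph beta : f g / (f `&` g)%O} &
        {morph beta : f g / (f `|` g)%O}]
    /\ forall f1 f2 : plott_fun X,
         Bas (f1 `&` f2)%O = Bas f1 :&: Bas f2 /\
         Bas (f1 `|` f2)%O = hull (Bas f1 :|: Bas f2).
Proof.
pose beta (f : plott_fun X) := ConvexSet (Bas_convex f).
have bij : bijective beta.
  exists (fun C : convex_set X => plott_of C) => [f | C].
    exact: plott_of_Bas.
  by apply: val_inj; apply: Bas_plott_of.
have mono : {mono beta : f g / (f <= g)%O} by move=> f g; apply: Bas_le.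
have morphI := mono_bij_meet bij mono; have morphU := mono_bij_join bij mono.
exists beta; split=> // f1 f2; split.
- exact: (congr1 (@cs_val X) (morphI f1 f2)).
- exact: (congr1 (@cs_val X) (morphU f1 f2)).
Qed.
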